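(* Let $\mathcal{T}$ be a planar triangulation, $m\in\mathbb{Z}_{\ge0}$, $r\in\mathbb{Z}_{\ge-1}$, and $\mathbf{r}$ a smoothness distribution with $\mathbf r(\tau)\in\{r,-1\}$ for all interior edges, such that $\mathcal{Q}^{\mathbf r}$ is lower-acyclic. Let $\sigma$ be a face bounded by edges $\tau_1,\tau_2,\tau_3$, and let $\gamma_i=\tau_i\cap\tau_{i+1}$ (indices cyclic in $1,2,3$) be interior vertices of $\mathcal{T}$. Assume that for all $i\in\{1,2,3\}$: $\mathbf{r}(\tau_i)=r$, and $\mathbf{r}(\tau)\neq-1$ for every edge $\tau$ incident on $\gamma_i$. Suppose $\gamma_i$ has $n_i$ distinct slopes, and put $t_i=\min\{r+2,n_i\}$ and $\Omega_i=r+\left\lceil\frac{r+1}{t_i-1}\right\rceil$ for $i=1,2,3$. If $$m>\frac{\Omega_1+\Omega_2+\Omega_3-3}{2},$$ then $\mathcal{Q}^{\mathbf s}$ is lower-acyclic, where $\mathbf s(\tau)=\mathbf r(\tau)$ for interior edges $\tau\notin\{\tau_1,\tau_2,\tau_3\}$ and $\mathbf s(\tau_i)=-1$ for $i=1,2,3$.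
   Context: $\mathcal{T}$ is a finite planar triangulation of a closed polygonal region $\Omega\subset\mathbb{R}^2$ (possibly not simply connected). An edge or vertex is interior if not contained in $\partial\Omega$; $\mathcal{T}^\circ_1,\mathcal{T}^\circ_0$ denote interior edges and vertices, $\mathcal{T}_2$ the faces. The number of distinct slopes at a vertex $\gamma$ is the number of distinct directions (lines through $\gamma$) among the edges containing $\gamma$. ${\mathcal{P}}_m$ is the space of real bivariate polynomials of total degree at most $m$; $\langle f_1,\dots,f_k\rangle$ denotes the subspace of ${\mathcal{P}}_m$ of polynomial combinations $\sum g_if_i$ lying in ${\mathcal{P}}_m$. A smoothness distribution is a map $\mathbf{r}:\mathcal{T}^\circ_1\to\mathbb{Z}_{\ge -1}$. For $\tau\in\mathcal{T}^\circ_1$ with vanishing affine-linear form $\ell_\tau$, $\mathfrak{J}^{\mathbf r}_\tau=\langle \ell_\tau^{\mathbf r(\tau)+1}\rangle$ (equal to ${\mathcal{P}}_m$ if $\mathbf r(\tau)=-1$); for $\gamma\in\mathcal{T}^\circ_0$, $\mathfrak{J}^{\mathbf r}_\gamma=\sum_{\tau\ni\gamma}\mathfrak{J}^{\mathbf r}_\tau$. $\mathcal{C}$ is the chain complex $\bigoplus_{\sigma\in\mathcal{T}_2}{\mathcal{P}}_m\to\bigoplus_{\tau\in\mathcal{T}^\circ_1}{\mathcal{P}}_m\to\bigoplus_{\gamma\in\mathcal{T}^\circ_0}{\mathcal{P}}_m$ (degrees $2,1,0$) with the cellular boundary maps of $\mathcal{T}$ relative to $\partial\Omega$ (signs $\pm1$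 from fixed orientations); $\mathcal{I}^{\mathbf r}$ is the subcomplex $0\to\bigoplus_\tau\mathfrak{J}^{\mathbf r}_\tau\to\bigoplus_\gamma\mathfrak{J}^{\mathbf r}_\gamma$; $\mathcal{Q}^{\mathbf r}=\mathcal{C}/\mathcal{I}^{\mathbf r}$, whose $H_2$ is the space of piecewise polynomials in ${\mathcal{P}}_m$ that are $C^{\mathbf r(\tau)}$ across each interior edge $\tau$. $\mathcal{Q}^{\mathbf r}$ is lower-acyclic if $H_1(\mathcal{Q}^{\mathbf r})=H_0(\mathcal{Q}^{\mathbf r})=0$. *)

(* Defs.v *)
From mathcomp Require Import all_boot all_order all_algebra.
From mathcomp Require Import boolp reals.
From mathcomp Require Import mpoly.
Set Implicit Arguments. Unset Strict Implicit. Unset Printing Implicit Defensive.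
Import Order.TTheory GRing.Theory Num.Theory.
Local Open Scope ring_scope.

(* twice the signed area of the triangle (a,b,c); > 0 iff counterclockwise *)
Definition orient (R : realType) (a b c : R * R) : R :=
  (b.1 - a.1) * (c.2 - a.2) - (b.2 - a.2) * (c.1 - a.1).

(* convex hull of the positions of the vertices in S (empty if S = set0) *)
Definition hull (R : realType) (V : finType) (pos : V -> R * R)
    (S : {set V}) (p : R * R) : Prop :=
  exists c : V -> R,
    [/\ (forall v, 0 <= c v), (forall v, v \notin S -> c v = 0),
        \sum_v c v = 1 &
        p = (\sum_v c v * (pos v).1, \sum_v c v * (pos v).2)].

Definition region (R : realType) (V : finType) (pos : V -> R * R)
    (faces : {set {set V}}) (p : R * R) : Prop :=
  exists2 s, s \in faces & hull pos s p.

Definition on_boundary (R : realType) (V : finType) (pos : V -> R * R)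
    (faces : {set {set V}}) (p : R * R) : Prop :=
  region pos faces p /\
  forall e : R, 0 < e -> exists q : R * R,
    [/\ ~ region pos faces q, `|q.1 - p.1| < e & `|q.2 - p.2| < e].

Definition is_triangulation (R : realType) (V : finType) (pos : V -> R * R)
    (faces : {set {set V}}) : Prop :=
  [/\ (forall s, s \in faces -> exists a b c,
          s = [set a; b; c] /\ orient (pos a) (pos b) (pos c) != 0),
      (forall v, exists2 s, s \in faces & v \in s) &
      (forall s s', s \in faces -> s' \in faces -> forall p,
          (hull pos s p /\ hull pos s' p) <-> hull pos (s :&: s') p)].

Definition edges (V : finType) (faces : {set {set V}}) : {set {set V}} :=
  [set e : {set V} | (#|e| == 2) && [exists s in faces, e \subset s]].

Definition int_edge (R : realType) (V : finType) (pos : V -> R * R)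
    (faces : {set {set V}}) (e : {set V}) : Prop :=
  e \in edges faces /\ ~ (forall p, hull pos e p -> on_boundary pos faces p).

Definition int_edges (R : realType) (V : finType) (pos : V -> R * R)
    (faces : {set {set V}}) : {set {set V}} :=
  [set e | `[< int_edge pos faces e >]].

Definition int_vertex (R : realType) (V : finType) (pos : V -> R * R)
    (faces : {set {set V}}) (v : V) : Prop :=
  ~ on_boundary pos faces (pos v).

Definition slope (R : realType) (a b : R * R) : option R :=
  if b.1 == a.1 then None else Some ((b.2 - a.2) / (b.1 - a.1)).

Definition nslopes (R : realType) (V : finType) (pos : V -> R * R)
    (faces : {set {set V}}) (g : V) : nat :=
  size (undup [seq slope (pos g) (pos u) | u <- enum V &
                 [set u; g] \in edges faces]).

(* Omega_i = r + ceil((r+1)/(t-1)), t = min(r+2, n) ; (x/0 = 0 by convention) *)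
Definition OmegaNum (r : int) (n : nat) : int :=
  let t := Num.min (r + 2) (n%:Z) in
  r + Num.ceil ((r + 1)%:~R / (t - 1)%:~R : rat).

Definition Pm (R : realType) (m : nat) (p : {mpoly R[2]}) : Prop :=
  (msize p <= m.+1)%N.

(* the affine-linear form vanishing on the line through pos u and pos v *)
Definition ell (R : realType) (V : finType) (pos : V -> R * R) (u v : V)
    : {mpoly R[2]} :=
  ((pos v).2 - (pos u).2)%:MP * ('X_ord0 - ((pos u).1)%:MP)
  - ((pos v).1 - (pos u).1)%:MP * ('X_ord_max - ((pos u).2)%:MP).

(* membership in J_tau = < ell_tau ^ (k+1) > (= P_m when k = -1) *)
Definition inJe (R : realType) (V : finType) (pos : V -> R * R) (m : nat)
    (k : int) (e : {set V}) (p : {mpoly R[2]}) : Prop :=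
  Pm m p /\ exists u v, e = [set u; v] /\
    exists q : {mpoly R[2]}, p = ell pos u v ^+ absz (k + 1) * q.

Definition inJv (R : realType) (V : finType) (pos : V -> R * R)
    (faces : {set {set V}}) (m : nat) (rr : {set V} -> int) (g : V)
    (p : {mpoly R[2]}) : Prop :=
  exists f : {set V} -> {mpoly R[2]},
    (forall e, e \in int_edges pos faces -> g \in e -> inJe pos m (rr e) e (f e))
    /\ p = \sum_(e in int_edges pos faces | g \in e) f e.

(* The cellular chain complex relative to the boundary.  Edges are oriented *)
(* from the vertex of smaller enum_rank to the larger one; faces are        *)
(* oriented counterclockwise.  Chains are functions on cells; only the      *)
(* values on faces / interior edges / interior vertices are relevant.        *)

Definition sgn1 (R : realType) (V : finType) (e : {set V}) (g : V) : R :=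
  if [exists u, (e == [set u; g]) && (enum_rank u < enum_rank g)%N]
  then 1 else -1.

Definition sgn2 (R : realType) (V : finType) (pos : V -> R * R)
    (s e : {set V}) : R :=
  if [exists u, exists v, exists w,
        [&& e == [set u; v], s == [set u; v; w], w \notin e,
            (enum_rank u < enum_rank v)%N &
            0 < orient (pos u) (pos v) (pos w)]]
  then 1 else -1.

Definition d1 (R : realType) (V : finType) (pos : V -> R * R)
    (faces : {set {set V}}) (c1 : {set V} -> {mpoly R[2]}) (g : V)
    : {mpoly R[2]} :=
  \sum_(e in int_edges pos faces | g \in e) sgn1 R e g *: c1 e.

Definition d2 (R : realType) (V : finType) (pos : V -> R * R)
    (faces : {set {set V}}) (c2 : {set V} -> {mpoly R[2]}) (e : {set V})
    : {mpoly R[2]} :=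
  \sum_(s in faces | e \subset s) sgn2 pos s e *: c2 s.

(* Q^r is lower-acyclic: H_1(Q^r) = 0 and H_0(Q^r) = 0, where
   Q^r = C / I^r, Q_1 = (+)_tau P_m / J_tau, Q_0 = (+)_gamma P_m / J_gamma. *)
Definition lower_acyclic (R : realType) (V : finType) (pos : V -> R * R)
    (faces : {set {set V}}) (m : nat) (rr : {set V} -> int) : Prop :=
  (forall c1 : {set V} -> {mpoly R[2]},
     (forall e, Pm m (c1 e)) ->
     (forall g, int_vertex pos faces g -> inJv pos faces m rr g (d1 pos faces c1 g)) ->
     exists c2 : {set V} -> {mpoly R[2]},
       (forall s, Pm m (c2 s)) /\
       (forall e, int_edge pos faces e ->
          inJe pos m (rr e) e (c1 e - d2 pos faces c2 e)))
  /\
  (forall c0 : V -> {mpoly R[2]},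
     (forall g, Pm m (c0 g)) ->
     exists c1 : {set V} -> {mpoly R[2]},
       (forall e, Pm m (c1 e)) /\
       (forall g, int_vertex pos faces g ->
          inJv pos faces m rr g (c0 g - d1 pos faces c1 g))).

(* Main.v *)
Require Import Defs.
From mathcomp Require Import all_boot all_order all_algebra.
From mathcomp Require Import boolp reals.
From mathcomp Require Import mpoly.
From mathcomp Require Import ring zify.
Set Implicit Arguments. Unset Strict Implicit. Unset Printing Implicit Defensive.
Import Order.TTheory GRing.Theory Num.Theory.
Local Open Scope ring_scope.

(* Relaxing the three edges of the triangle does not change H_0 = 0, and the long exact sequence
   of I^s / I^r -> Q^r -> Q^s reduces H_1(Q^s) = 0 to the identity J_1 + J_2 + J_3 = P_m
   for the vertex ideals J_i = J^r_(gamma_i).  Each J_i contains every polynomial of P_m vanishing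
   to order at least Omega_i at gamma_i: the powers of exponent r + 1 of n_i distinct linear forms
   in two variables span all forms of degree at least Omega_i.  In barycentric coordinates every
   monomial of degree m lies in one of the J_i as soon as 2 m > Omega_1 + Omega_2 + Omega_3 - 3. *)

(** * Powers of linear forms *)

(* The derivative, in the direction [(a, 1)], of the homogenization of [p] in degree [n]. *)
Definition polar_deriv (R : comNzRingType) (n : nat) (a : R) (p : {poly R}) : {poly R} :=
  n%:R * p - ('X - a%:P) * p^`().

Lemma polar_derivD (R : comNzRingType) n (a : R) p q :
  polar_deriv n a (p + q) = polar_deriv n a p + polar_deriv n a q.
Proof. by rewrite /polar_deriv derivD; ring. Qed.

Lemma polar_derivB (R : comNzRingType) n (a : R) p q :
  polar_deriv n a (p - q) = polar_deriv n a p - polar_deriv n a q.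
Proof. by rewrite /polar_deriv derivB; ring. Qed.

Lemma polar_deriv_sum (R : comNzRingType) n (a : R) (I : Type) (s : seq I) (f : I -> {poly R}) :
  polar_deriv n a (\sum_(i <- s) f i) = \sum_(i <- s) polar_deriv n a (f i).
Proof.
elim: s => [|i s IH]; first by rewrite !big_nil /polar_deriv derivC !mulr0 subr0.
by rewrite !big_cons polar_derivD IH.
Qed.

(** The direction [(a, 1)] is tangent to the line x = a z, so the derivation kills x - a z and
    commutes with multiplication by it. *)
Lemma polar_deriv_mul_XsubC (R : comNzRingType) n (a : R) p :
  polar_deriv n.+1 a (('X - a%:P) * p) = ('X - a%:P) * polar_deriv n a p.
Proof. by rewrite /polar_deriv derivM derivXsubC; ring. Qed.

(** One power of x - b z is lost. Modulo ['X - b], the bracket is [e.+1 (a - b) p], so no further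
    factor is lost systematically when [a != b]. *)
Lemma polar_deriv_mul_exp (R : comNzRingType) n e (a b : R) p :
  polar_deriv n a (('X - b%:P) ^+ e.+1 * p) =
  ('X - b%:P) ^+ e *
    ((n%:R * ('X - b%:P) - e.+1%:R * ('X - a%:P)) * p - ('X - a%:P) * ('X - b%:P) * p^`()).
Proof.
by rewrite /polar_deriv derivM deriv_exp derivXsubC exprS /= -mulr_natl; ring.
Qed.

Lemma poly_shift_decomp (R : idomainType) n (a : R) (p : {poly R}) :
  (size p <= n.+1)%N ->
  exists (c : R) (q : {poly R}), (size q <= n)%N /\ p = c%:P + ('X - a%:P) * q.
Proof.
move=> sp.
have /factor_theorem [q qE] : root (p - p.[a]%:P) a.
  by rewrite /root !hornerE subrr.
exists p.[a], q; split; last by rewrite mulrC -qE; ring.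
have [->|q0] := eqVneq q 0; first by rewrite size_poly0.
have : (size (q * ('X - a%:P))%R <= n.+1)%N.
  rewrite -qE (leq_trans (size_polyD _ _)) // geq_max sp size_polyN.
  by rewrite (leq_trans (size_polyC_leq1 _)).
by rewrite size_Mmonic ?monicXsubC // size_XsubC addn2.
Qed.

(** Forms of degree [n] modulo x - b z are a line, and (x - a z)^n spans it because it does not
    vanish at [b]. *)
Lemma poly_two_point_decomp (R : fieldType) n (a b : R) (p : {poly R}) :
  a != b -> (size p <= n.+1)%N ->
  exists (c : R) (q : {poly R}), (size q <= n)%N /\ p = c *: ('X - a%:P) ^+ n + ('X - b%:P) * q.
Proof.
move=> ab sp; set c := p.[b] / (b - a) ^+ n.
have sp' : (size (p - c *: ('X - a%:P) ^+ n)%R <= n.+1)%N.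
  rewrite (leq_trans (size_polyD _ _)) // geq_max sp size_polyN.
  by rewrite (leq_trans (size_scale_leq _ _)) // size_exp_XsubC.
have [k [q [sq pE]]] := poly_shift_decomp b sp'.
have k0 : k = 0.
  move: (congr1 (fun u => u.[b]) pE); rewrite !hornerE subrr mul0r addr0.
  by rewrite /c divfK ?subrr // expf_neq0 // subr_eq0 eq_sym.
exists c, q; split=> //; move: pE; rewrite k0 add0r => <-; ring.
Qed.

Section PowerSpan.
Variable R : numFieldType.

Lemma size_lin_mul (a c : R) (q : {poly R}) n :
  (size q <= n)%N -> (size (c%:P + ('X - a%:P) * q)%R <= n.+1)%N.
Proof.
move=> sq; rewrite (leq_trans (size_polyD _ _)) // geq_max.
rewrite (leq_trans (size_polyC_leq1 _)) //= (leq_trans (size_polyMleq _ _)) //.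
by rewrite size_XsubC addSn /= ltnS.
Qed.

Lemma size_polar_deriv n (a : R) (p : {poly R}) :
  (size p <= n.+1)%N -> (size (polar_deriv n a p) <= n)%N.
Proof.
elim: n p => [|n IH] p sp.
  by rewrite (size1_polyC sp) /polar_deriv derivC mulr0 mul0r subrr size_poly0.
have [c [q [sq ->]]] := poly_shift_decomp a sp.
rewrite polar_derivD polar_deriv_mul_XsubC /polar_deriv derivC mulr0 subr0.
rewrite -polyC_natr -polyCM; exact/size_lin_mul/IH.
Qed.

(** The operator is diagonal in the powers of ['X - a]: the k-th power has eigenvalue n - k, which
    is nonzero for k < n in characteristic zero. *)
Lemma polar_deriv_surj n (a : R) (p : {poly R}) :
  (size p <= n)%N -> exists2 q : {poly R}, (size q <= n)%N & polar_deriv n a q = p.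
Proof.
elim: n p => [|n IH] p sp.
  exists 0; first by rewrite size_poly0.
  by move: sp; rewrite leqn0 size_poly_eq0 => /eqP ->; rewrite /polar_deriv linear0; ring.
have [c [p1 [sp1 ->]]] := poly_shift_decomp a sp.
have [q1 sq1 q1E] := IH _ sp1.
exists ((c / n.+1%:R)%:P + ('X - a%:P) * q1); first exact: size_lin_mul.
rewrite polar_derivD polar_deriv_mul_XsubC q1E /polar_deriv derivC mulr0 subr0.
by rewrite -polyC_natr -polyCM mulrC divfK // pnatr_eq0.
Qed.

(** Among the eigenvalues n - k with k <= n, only that of k = n vanishes. *)
Lemma polar_deriv_ker n (a : R) (p : {poly R}) :
  (size p <= n.+1)%N -> polar_deriv n a p = 0 -> exists c, p = c *: ('X - a%:P) ^+ n.
Proof.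
elim: n p => [|n IH] p sp p0.
  exists p`_0; rewrite expr0 alg_polyC; exact: size1_polyC.
have [c [p1 [sp1 pE]]] := poly_shift_decomp a sp.
move: p0; rewrite pE polar_derivD polar_deriv_mul_XsubC /polar_deriv derivC mulr0 subr0.
move=> p0.
have c0 : c = 0.
  move/(congr1 (fun u => u.[a])): p0; rewrite -polyC_natr !hornerE subrr mul0r addr0.
  by move/eqP; rewrite mulf_eq0 pnatr_eq0 /= => /eqP.
move: p0; rewrite c0 mulr0 add0r => /eqP; rewrite mulf_eq0 polyXsubC_eq0 /=.
move/eqP/(IH _ sp1) => [k kE]; by exists k; rewrite kE exprS add0r scalerAr.
Qed.

(** The form (x - b z)^(e+1) (x - a z)^k has derivative (e+1) (a - b) (x - b z)^e (x - a z)^k. This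
    settles the part of [p] not divisible by ['X - b]; the rest is the same problem with [e] raised
    and [k] lowered. *)
Lemma polar_deriv_lift k e (a b : R) (p : {poly R}) :
  a != b -> (size p <= k)%N ->
  exists2 q : {poly R}, (size q <= k)%N &
    polar_deriv (e + k) a (('X - b%:P) ^+ e.+1 * q) = ('X - b%:P) ^+ e * p.
Proof.
move=> ab; elim: k e p => [|k IH] e p sp.
  exists 0; first by rewrite size_poly0.
  move: sp; rewrite leqn0 size_poly_eq0 => /eqP ->.
  by rewrite /polar_deriv mulr0 linear0; ring.
have [c [p1 [sp1 pE]]] := poly_two_point_decomp ab sp.
have [q1 sq1 q1E] := IH e.+1 _ sp1.
have [c' cE] : exists c', c = c' * (e.+1%:R * (a - b)).
  exists (c / (e.+1%:R * (a - b))).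
  by rewrite divfK // mulf_neq0 ?pnatr_eq0 // subr_eq0.
exists (c' *: ('X - a%:P) ^+ k + ('X - b%:P) * q1).
  rewrite (leq_trans (size_polyD _ _)) // geq_max.
  rewrite (leq_trans (size_scale_leq _ _)) ?size_exp_XsubC //=.
  by rewrite (leq_trans (size_polyMleq _ _)) // size_XsubC addSn /= ltnS.
rewrite mulrDr polar_derivD addnS -addSn.
have -> : ('X - b%:P) ^+ e.+1 * (('X - b%:P) * q1) = ('X - b%:P) ^+ e.+2 * q1.
  by rewrite mulrA -exprSr.
rewrite q1E polar_deriv_mul_exp pE [RHS]mulrDr [in X in _ + X = _]exprSr -[X in _ + X = _]mulrA.
congr (_ + _); congr (_ * _).
rewrite cE -!mul_polyC !polyCM polyCB polyC_natr derivM derivC deriv_exp derivXsubC.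
rewrite -mulr_natl.
case: k {IH sp sp1 sq1 q1E pE} => [|k]; first by rewrite !expr0; ring.
rewrite /= !exprS; ring.
Qed.

(* Homogenized, the block of [a] consists of the forms of degree [d] divisible by the power
   [d + 1 - k a] of [x - a z].  The polar derivative at [a] maps each other block onto a block of
   the same dimension in degree [d - 1] and shortens the block of [a] by its kernel; this is
   the induction step. *)
Lemma power_blocks_span d (s : seq R) (k : R -> nat) (p : {poly R}) :
  uniq s -> (forall a, a \in s -> (k a <= d.+1)%N) ->
  (d < \sum_(a <- s) k a)%N -> (size p <= d.+1)%N ->
  exists2 q : R -> {poly R}, (forall a, a \in s -> (size (q a) <= k a)%N) &
    p = \sum_(a <- s) ('X - a%:P) ^+ (d.+1 - k a) * q a.
Proof.
(* A block of full size has exponent zero, so it contains every form by itself. *)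
have full n (t : seq R) (l : R -> nat) (f : {poly R}) a :
    uniq t -> a \in t -> l a = n.+1 -> (size f <= n.+1)%N ->
  exists2 q : R -> {poly R}, (forall b, b \in t -> (size (q b) <= l b)%N) &
    f = \sum_(b <- t) ('X - b%:P) ^+ (n.+1 - l b) * q b.
  move=> ut at_ la sf; exists (fun b => if b == a then f else 0).
    by move=> b _; case: eqP => [->|_]; rewrite ?la ?size_poly0.
  rewrite (bigD1_seq a) //= eqxx la subnn mul1r big1 ?addr0 // => b /negPf ->.
  by rewrite mulr0.
move=> us; elim: d k p => [|d IH] k p kd sk sp.
  have [a as_ ka] : exists2 a, a \in s & (0 < k a)%N.
    case: (boolP (has (fun a => 0 < k a)%N s)) => [/hasP //|/hasPn h].
    by move: sk; rewrite big1_seq // => a /andP [_ /h]; rewrite -eqn0Ngt => /eqP.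
  by apply: (full _ _ _ _ a) => //; have := kd _ as_; lia.
case: (boolP (has (fun a => k a == d.+2)%N s)) => [/hasP [a as_ /eqP ka]|/hasPn h].
  exact: (full _ _ _ _ a).
have {}kd a : a \in s -> (k a <= d.+1)%N.
  by move=> as_; have := kd _ as_; have := h _ as_; lia.
have [a as_ ka] : exists2 a, a \in s & (0 < k a)%N.
  case: (boolP (has (fun a => 0 < k a)%N s)) => [/hasP //|/hasPn h0].
  by move: sk; rewrite big1_seq // => a /andP [_ /h0]; rewrite -eqn0Ngt => /eqP.
(* Both the degree and the total size of the blocks drop by one, so the strict inequality
   persists. *)
pose k' b := if b == a then (k a).-1 else k b.
have [|||q' sq' q'E] := IH k' (polar_deriv d.+1 a p).
- move=> b bs; rewrite /k'; case: eqP => _; last exact: kd.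
  by have := kd _ as_; lia.
- move: sk; rewrite !(bigD1_seq a) //= {1}/k' eqxx.
  rewrite [X in _ -> (_ < _ + X)%N](eq_bigr k) => [|b /negPf]; last by rewrite /k' => ->.
  lia.
- exact: size_polar_deriv.
(* Lift each block of the derivative separately. At [b = a] the power of ['X - a] passes through the
   derivation; elsewhere [polar_deriv_lift] applies. *)
have /choice [h0 h0P] : forall b, exists g : {poly R}, b \in s -> (size g <= k b)%N /\
    polar_deriv d.+1 a (('X - b%:P) ^+ (d.+2 - k b) * g) =
    ('X - b%:P) ^+ (d.+1 - k' b) * q' b.
  move=> b; case: (boolP (b \in s)) => bs; last by exists 0.
  have kb := kd _ bs; have sb := sq' _ bs; move: sb; rewrite /k'.
  have [->|ba] := eqVneq b a => sb.
    have [g sg gE] := polar_deriv_surj a sb.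
    exists g => _; split; first by rewrite (leq_trans sg) ?leq_pred.
    have -> : (d.+1 - (k a).-1 = d.+2 - k a)%N by lia.
    rewrite -gE; have {1}-> : d.+1 = (d.+2 - k a + (k a).-1)%N by have := kd _ as_; lia.
    by elim: (d.+2 - k a)%N => [|e IHe]; rewrite ?mul1r ?expr0 // !exprS -!mulrA
      polar_deriv_mul_XsubC IHe.
  have ab : a != b by rewrite eq_sym.
  have [g sg gE] := polar_deriv_lift (d.+1 - k b) ab sb.
  exists g => _; split=> //; rewrite -gE subSn // subnK //.
(* The error of the lifted sum lies in the kernel, hence is a multiple of (x - a z)^(d+1), which
   belongs to the nonempty block of [a]. *)
have [||c cE] := @polar_deriv_ker d.+1 a
    (p - \sum_(b <- s) ('X - b%:P) ^+ (d.+2 - k b) * h0 b).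
- rewrite (leq_trans (size_polyD _ _)) // geq_max sp size_polyN.
  rewrite big_seq; elim/big_ind: _ => [|u v su sv|b bs]; first by rewrite size_poly0.
    by rewrite (leq_trans (size_polyD _ _)) // geq_max; apply/andP.
  rewrite (leq_trans (size_polyMleq _ _)) // size_exp_XsubC addSn /=.
  have [sb _] := h0P _ bs; rewrite (leq_trans (leq_add (leqnn _) sb)) // subnK //.
  exact/leqW/kd.
- rewrite polar_derivB polar_deriv_sum q'E; apply/eqP; rewrite subr_eq0; apply/eqP.
  by apply: eq_big_seq => b /h0P [].
exists (fun b => h0 b + if b == a then c *: ('X - a%:P) ^+ (k a).-1 else 0).
  move=> b bs; rewrite (leq_trans (size_polyD _ _)) // geq_max (h0P _ bs).1 /=.
  have [->|_] := eqVneq b a; last by rewrite size_poly0.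
  by rewrite (leq_trans (size_scale_leq _ _)) // size_exp_XsubC prednK.
rewrite (eq_bigr (fun b => ('X - b%:P) ^+ (d.+2 - k b) * h0 b +
   (if b == a then c *: ('X - a%:P) ^+ d.+1 else 0))) => [|b _]; last first.
  rewrite mulrDr; congr (_ + _); case: eqP => [->|_]; last by rewrite mulr0.
  rewrite -scalerAr -exprD; congr (_ *: _ ^+ _); have := kd _ as_; lia.
rewrite big_split /= [X in _ + X](bigD1_seq a) //= eqxx [X in _ + (_ + X)]big1.
  by rewrite addr0 -cE addrC subrK.
by move=> b /negPf ->.
Qed.
End PowerSpan.

(** * Homogenization at a pair of algebra elements *)

Definition homogenize (R : comNzRingType) (A : comAlgType R) (x z : A) (d : nat)
    (p : {poly R}) : A :=
  \sum_(k < d.+1) p`_k *: (x ^+ k * z ^+ (d - k)).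

Section Homogenize.
Variables (R : comNzRingType) (A : comAlgType R) (x z : A).
Local Notation hom := (homogenize x z).

Lemma homogenizeD d p q : hom d (p + q) = hom d p + hom d q.
Proof. by rewrite -big_split; apply: eq_bigr => k _; rewrite coefD scalerDl. Qed.

Lemma homogenizeZ d c p : hom d (c *: p) = c *: hom d p.
Proof. by rewrite scaler_sumr; apply: eq_bigr => k _; rewrite coefZ scalerA. Qed.

Lemma homogenize_sum d (I : Type) (s : seq I) (f : I -> {poly R}) :
  hom d (\sum_(i <- s) f i) = \sum_(i <- s) hom d (f i).
Proof.
elim: s => [|i s IH]; last by rewrite !big_cons homogenizeD IH.
by rewrite !big_nil /homogenize big1 // => k _; rewrite coef0 scale0r.
Qed.

Lemma homogenizeXM d p : hom d.+1 ('X * p) = x * hom d p.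
Proof.
rewrite /homogenize big_ord_recl coefXM /= scale0r add0r mulr_sumr.
by apply: eq_bigr => k _; rewrite coefXM /= -scalerAr exprS mulrA.
Qed.

Lemma homogenizeS d (p : {poly R}) : (size p <= d.+1)%N -> hom d.+1 p = z * hom d p.
Proof.
move=> sp; rewrite /homogenize big_ord_recr /= nth_default // scale0r addr0 mulr_sumr.
apply: eq_bigr => k _; rewrite -scalerAr subSn ?leq_ord // exprS; congr (_ *: _); ring.
Qed.

Lemma size_lin_comb_mul (a b : R) (p : {poly R}) n :
  (size p <= n)%N -> (size ((a *: 'X + b%:P) * p)%R <= n.+1)%N.
Proof.
move=> sp; rewrite (leq_trans (size_polyMleq _ _)) //.
have : (size (a *: 'X + b%:P)%R <= 2)%N.
  rewrite (leq_trans (size_polyD _ _)) // geq_max.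
  rewrite (leq_trans (size_scale_leq _ _)) ?size_polyX //=.
  by rewrite (leq_trans (size_polyC_leq1 _)).
by move=> s2; rewrite -subn1 leq_subLR (leq_trans (leq_add s2 sp)).
Qed.

Lemma homogenize_linM d (a b : R) (p : {poly R}) : (size p <= d.+1)%N ->
  hom d.+1 ((a *: 'X + b%:P) * p) = (a *: x + b *: z) * hom d p.
Proof.
move=> sp; rewrite mulrDl -scalerAl mul_polyC homogenizeD !homogenizeZ.
by rewrite homogenizeXM homogenizeS // mulrDl !scalerAl.
Qed.

Lemma homogenize_XsubC_exp e k (a : R) (p : {poly R}) : (size p <= k.+1)%N ->
  hom (e + k) (('X - a%:P) ^+ e * p) = (x - a *: z) ^+ e * hom k p.
Proof.
move=> sp; elim: e => [|e IH]; first by rewrite !mul1r.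
have -> : 'X - a%:P = 1 *: 'X + (- a)%:P :> {poly R} by rewrite scale1r polyCN.
rewrite exprS -mulrA addSn homogenize_linM.
  rewrite scale1r polyCN IH scale1r scaleNr exprS mulrA //.
elim: e {IH} => [|e IH]; first by rewrite mul1r.
by rewrite exprS -mulrA addSn size_lin_comb_mul.
Qed.

(** Carries a product of linear forms to a univariate polynomial, where [power_blocks_span] applies.
    The coefficient of [x] may vanish, so only an upper bound on the size is available. *)
Lemma lin_exp_mul_homogenize (a b a' b' : R) i j :
  exists2 p : {poly R}, (size p <= (i + j).+1)%N &
    hom (i + j) p = (a *: x + b *: z) ^+ i * (a' *: x + b' *: z) ^+ j.
Proof.
elim: i => [|i [p sp pE]].
  elim: j => [|j [p sp pE]].
    exists 1; rewrite ?size_poly1 // /homogenize big_ord1 coef1 scale1r !expr0 //.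
  exists ((a' *: 'X + b'%:P) * p); first exact: size_lin_comb_mul.
  by rewrite !add0n in pE sp *; rewrite homogenize_linM // pE !mul1r exprS.
exists ((a *: 'X + b%:P) * p); first exact: size_lin_comb_mul.
by rewrite addSn homogenize_linM // pE exprS mulrA.
Qed.
End Homogenize.

(** * Degree bounds *)

Section PmClosed.
Variable R : realType.
Implicit Types p q : {mpoly R[2]}.

Lemma Pm0 m : Pm m (0 : {mpoly R[2]}).
Proof. by rewrite /Pm msize0. Qed.

Lemma PmD m p q : Pm m p -> Pm m q -> Pm m (p + q).
Proof. by move=> hp hq; rewrite /Pm (leq_trans (msizeD_le _ _)) // geq_max; apply/andP. Qed.

Lemma PmZ m (c : R) p : Pm m p -> Pm m (c *: p).
Proof. by move=> hp; rewrite /Pm (leq_trans (msizeZ_le _ _)). Qed.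

Lemma PmB m p q : Pm m p -> Pm m q -> Pm m (p - q).
Proof. by move=> hp hq; apply: PmD => //; rewrite -scaleN1r; apply: PmZ. Qed.

Lemma PmM m n p q : Pm m p -> Pm n q -> Pm (m + n) (p * q).
Proof.
rewrite /Pm; have [->|p0] := eqVneq p 0; first by rewrite mul0r msize0.
have [->|q0] := eqVneq q 0; first by rewrite mulr0 msize0.
by move=> hp hq; rewrite msizeM // -subn1 leq_subLR (leq_trans (leq_add hp hq)) // addSn addnS.
Qed.

Lemma PmC m (c : R) : Pm m (c%:MP : {mpoly R[2]}).
Proof. by rewrite /Pm msizeC (leq_trans (leq_b1 _)). Qed.

Lemma Pm_sum m (I : Type) (s : seq I) (P : pred I) (f : I -> {mpoly R[2]}) :
  (forall i, P i -> Pm m (f i)) -> Pm m (\sum_(i <- s | P i) f i).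
Proof. by move=> h; elim/big_ind: _ => //; [exact: Pm0|exact: PmD]. Qed.

Lemma Pm_exp n p : Pm 1 p -> Pm n (p ^+ n).
Proof.
move=> hp; elim: n => [|n IH]; first by rewrite expr0 -mpolyC1; apply: PmC.
by rewrite exprS; apply: (@PmM 1).
Qed.

Lemma Pm_X m (i : 'I_2) : Pm m.+1 ('X_i : {mpoly R[2]}).
Proof. by rewrite /Pm msizeX mdeg1. Qed.

Lemma Pm_homogenize d (x z : {mpoly R[2]}) (p : {poly R}) :
  Pm 1 x -> Pm 1 z -> Pm d (homogenize x z d p).
Proof.
move=> hx hz; apply: Pm_sum => k _; apply: PmZ.
by rewrite -{1}(subnKC (leq_ord k)); apply: PmM; apply: Pm_exp.
Qed.

Lemma Pm_ell (V : finType) (pos : V -> R * R) u v : Pm 1 (ell pos u v).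
Proof.
by apply: PmB; rewrite mul_mpolyC; apply: PmZ; apply: PmB; [exact: Pm_X|exact: PmC|exact: Pm_X|exact: PmC].
Qed.
End PmClosed.

(** With t = min(rho + 2, n), the bound on the ceiling reads rho + 1 <= (t - 1) (d - rho), that is d
    < t (d - rho). The second conclusion is the count [power_blocks_span] requires of [n] blocks of
    size d - rho. *)
Lemma OmegaNum_lt (rho n d : nat) :
  (2 <= n)%N -> OmegaNum rho n <= d -> (rho < d)%N /\ (d < n * (d - rho))%N.
Proof.
move=> n2; rewrite /OmegaNum; set t := Num.min _ _ => h.
have [tn t2] : t <= n /\ 2 <= t by rewrite /t; lia.
have : ((rho%:Z + 1)%:~R / (t - 1)%:~R : rat) <= (d%:Z - rho%:Z)%:~R.
  by rewrite -Num.Theory.ceil_le_int lerBrDl.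
rewrite ler_pdivrMr ?ltr0z; last by lia.
rewrite -intrM ler_int => h2.
have : (rho < d)%N by nia.
by split=> //; nia.
Qed.

(** * Vertex ideals *)

Lemma set2_inj (T : finType) (u v u' v' : T) :
  [set u; v] = [set u'; v'] -> (u = u' /\ v = v') \/ (u = v' /\ v = u').
Proof.
move=> /setP E; have := E u; have := E v; have := E u'; have := E v'; rewrite !inE !eqxx ?orbT /=.
move=> /orP v'E /orP u'E /esym/orP vE /esym/orP uE.
move: vE uE v'E u'E => [] /eqP -> [] /eqP ->; rewrite ?eqxx; try by [left|right].
  by move=> [] /eqP ->; left.
by move=> _ [] /eqP ->; left.
Qed.

Section Ideals.
Variables (R : realType) (V : finType) (pos : V -> R * R) (faces : {set {set V}}) (m : nat).
Implicit Types (p q : {mpoly R[2]}) (rr : {set V} -> int).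

Lemma ellC u v : ell pos v u = - ell pos u v.
Proof. by rewrite /ell !mpolyCB; ring. Qed.

Lemma inJe0 k u v : inJe pos m k [set u; v] 0.
Proof. by split; [exact: Pm0|exists u, v; split=> //; exists 0; rewrite mulr0]. Qed.

Lemma inJeD k e p q : inJe pos m k e p -> inJe pos m k e q -> inJe pos m k e (p + q).
Proof.
move=> [mp [u [v [-> [p' pE]]]]] [mq [u' [v' [/set2_inj uv [q' qE]]]]].
split; first exact: PmD.
exists u, v; split=> //; rewrite pE qE; case: uv => [[-> ->]|[-> ->]].
  by exists (p' + q'); rewrite mulrDr.
(* The two witnesses may order the endpoints oppositely, which changes the sign of [ell]; the power
   of -1 absorbs it. *)
exists (p' + (-1) ^+ absz (k + 1) * q').
by rewrite mulrDr (ellC v' u') (exprNn (ell pos v' u')) [in RHS]mulrCA mulrA.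
Qed.

Lemma int_edgesP e : reflect (int_edge pos faces e) (e \in int_edges pos faces).
Proof. by rewrite inE; apply: asboolP. Qed.

Lemma edge_set2 e : e \in edges faces -> exists u v, e = [set u; v] /\ u != v.
Proof. by rewrite inE => /andP [/cards2P [u [v [uv eE]]] _]; exists u, v. Qed.

Lemma int_edge_set2 e : e \in int_edges pos faces -> exists u v, e = [set u; v].
Proof. by move=> /int_edgesP [/edge_set2 [u [v [-> _]]] _]; exists u, v. Qed.

Lemma inJv0 rr g : inJv pos faces m rr g 0.
Proof.
exists (fun _ => 0); split; last by rewrite big1.
by move=> e /int_edge_set2 [u [v ->]] _; apply: inJe0.
Qed.

Lemma inJvD rr g p q :
  inJv pos faces m rr g p -> inJv pos faces m rr g q -> inJv pos faces m rr g (p + q).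
Proof.
move=> [f [fJ ->]] [h [hJ ->]]; exists (fun e => f e + h e).
by split; [move=> e ei ge; apply: inJeD; [exact: fJ|exact: hJ]|rewrite big_split].
Qed.

Lemma inJv_edge rr g e p : e \in int_edges pos faces -> g \in e ->
  inJe pos m (rr e) e p -> inJv pos faces m rr g p.
Proof.
move=> ei ge pJ; exists (fun e' => if e' == e then p else 0); split.
  move=> e' e'i _; case: eqP => [->//|_].
  by have [u [v ->]] := int_edge_set2 e'i; apply: inJe0.
rewrite (bigD1 e) ?ei //= eqxx big1 ?addr0 // => e' /andP [_ /negPf ->] //.
Qed.

Lemma inJe_Pm k e p : inJe pos m k e p -> Pm m p. Proof. by case. Qed.

Lemma inJv_Pm rr g p : inJv pos faces m rr g p -> Pm m p.
Proof.
by move=> [f [fJ ->]]; apply: Pm_sum => e /andP [ei ge]; apply: inJe_Pm (fJ _ ei ge).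
Qed.

Lemma inJeN1 e p : e \in edges faces -> Pm m p -> inJe pos m (-1) e p.
Proof.
move=> /edge_set2 [u [v [-> _]]] mp; split=> //; exists u, v; split=> //.
by exists p; rewrite addNr mul1r.
Qed.
End Ideals.

(** * Edges at interior vertices and nondegenerate faces *)

Section Geometry.
Variables (R : realType) (V : finType) (pos : V -> R * R) (faces : {set {set V}}).
Hypothesis triang : is_triangulation pos faces.

(** The endpoint [g] is itself a point of the edge off the boundary; its convex weights are the
    indicator of [g]. *)
Lemma int_edge_at u g : int_vertex pos faces g -> [set u; g] \in edges faces ->
  int_edge pos faces [set u; g].
Proof.
move=> ig ue; split=> // /(_ (pos g)) h; apply/ig/h.
exists (fun v => (v == g)%:R); split.
- by move=> v; rewrite ler0n.
- by move=> v; rewrite !inE negb_or => /andP [_ /negPf ->].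
- by rewrite (bigD1 g) //= eqxx big1 ?addr0 // => v /negPf ->.
have S (f : V -> R) : \sum_v (v == g)%:R * f v = f g.
  by rewrite (bigD1 g) //= eqxx mul1r big1 ?addr0 // => v /negPf ->; rewrite mul0r.
by rewrite !S; case: (pos g).
Qed.

Lemma edge_pos_neq u g : [set u; g] \in edges faces -> pos u != pos g.
Proof.
rewrite inE => /andP [ug /existsP [s /andP [sf /subsetP us]]].
have {}ug : u != g by move: ug; rewrite cards2; case: (u == g).
have [t1 _ _] := triang; have [a [b [c [sE O0]]]] := t1 _ sf.
have := us u; have := us g; rewrite sE !inE !eqxx ?orbT /= => /(_ isT) hg /(_ isT) hu.
apply: contraNneq O0 => posE.
move: hu hg ug posE => /orP [/orP []|] /eqP -> /orP [/orP []|] /eqP -> //; rewrite ?eqxx // /orient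
  => _ ->; apply/eqP; ring.
Qed.

(** The triangulation supplies some enumeration of the face. Permuting vertices changes [orient] at
    most by a sign, and a repeated vertex would make it zero. *)
Lemma orient_face (g1 g2 g3 : V) : [set g1; g2; g3] \in faces ->
  orient (pos g1) (pos g2) (pos g3) != 0.
Proof.
have [t1 _ _] := triang; move=> /t1 [a [b [c [E O0]]]].
have : a \in [set g1; g2; g3] by rewrite E !inE eqxx.
have : b \in [set g1; g2; g3] by rewrite E !inE eqxx orbT.
have : c \in [set g1; g2; g3] by rewrite E !inE eqxx orbT.
rewrite !inE => hc hb ha; apply: contraNneq O0 => O1.
move: hc hb ha O1 => /orP [/orP []|] /eqP -> /orP [/orP []|] /eqP -> /orP [/orP []|] /eqP ->;
  rewrite /orient => O1; apply/eqP; first [ring | rewrite -O1; ring | rewrite -[RHS]oppr0 -O1; ring].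
Qed.
End Geometry.

(** * Slopes and the ideal of an interior vertex *)

Lemma exists_Some_notin (R : realType) (t : seq (option R)) : exists s, Some s \notin t.
Proof.
have [M MP] : exists M : R, forall s, Some s \in t -> s < M.
  elim: t => [|[x|] t [M MP]]; first by exists 0.
    exists (Num.max M (x + 1)) => s; rewrite inE lt_max => /orP [/eqP [->]|/MP ->//].
    by rewrite ltrDl ltr01 orbT.
  by exists M => s; rewrite inE => /MP.
by exists M; apply/negP => /MP; rewrite ltxx.
Qed.

(* Coordinate of a direction in the chart of the projective line where the slope [s] is at
   infinity, so that all the edges at a vertex are finite points. *)
Definition slope_chart (R : realType) (s : R) (o : option R) : R :=
  if o is Some t then (t - s)^-1 else 0.

Lemma slope_chart_inj (R : realType) (s : R) (t : seq (option R)) : Some s \notin t ->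
  {in t &, injective (slope_chart s)}.
Proof.
move=> st x y xt yt.
have h z : Some z \in t -> (z - s)^-1 != 0.
  move=> zt; rewrite invr_eq0 subr_eq0; apply: contraNneq st => <- //.
case: x y xt yt => [x|] [y|] //= xt yt.
- by move/invr_inj/addIr ->.
- by move/eqP; rewrite (negPf (h _ xt)).
- by move/eqP; rewrite eq_sym (negPf (h _ yt)).
Qed.

Section VertexIdeal.
Variables (R : realType) (V : finType) (pos : V -> R * R) (faces : {set {set V}}) (m : nat).
Hypothesis triang : is_triangulation pos faces.

Local Notation X g := ('X_ord0 - ((pos g).1)%:MP : {mpoly R[2]}).
Local Notation Y g := ('X_ord_max - ((pos g).2)%:MP : {mpoly R[2]}).

(** Two independent edge directions have distinct slopes. For r >= 0 this keeps the denominator t -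
    1 of [OmegaNum] positive. *)
Lemma nslopes_ge2 g u v : [set u; g] \in edges faces -> [set v; g] \in edges faces ->
  orient (pos g) (pos u) (pos v) != 0 -> (2 <= nslopes pos faces g)%N.
Proof.
move=> ue ve O0; rewrite /nslopes.
set t := undup _.
have memt w : [set w; g] \in edges faces -> slope (pos g) (pos w) \in t.
  by move=> we; rewrite mem_undup; apply/map_f; rewrite mem_filter we mem_enum.
have uv : slope (pos g) (pos u) != slope (pos g) (pos v).
  apply: contraNneq O0; rewrite /slope /orient; case: eqP => [->|/eqP u1]; case: eqP => [->|/eqP v1] //.
    by move=> _; apply/eqP; ring.
  case=> E; apply/eqP.
  have -> : (pos u).2 - (pos g).2 = ((pos u).2 - (pos g).2) / ((pos u).1 - (pos g).1) * ((pos u).1 - (pos g).1).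
    by rewrite divfK // subr_eq0.
  by rewrite E mulrAC divfK ?subr_eq0 //; ring.
rewrite -[2%N]/(size [:: slope (pos g) (pos u); slope (pos g) (pos v)]).
apply: uniq_leq_size; first by rewrite /= inE uv.
by move=> w; rewrite !inE => /orP [] /eqP ->; apply: memt.
Qed.

(** For an edge vector (dx, dy), rewriting dy X - dx Y in X and Y - s X gives X the coefficient dy -
    s dx. This is nonzero as the slope is not [s], and dx divided by it is the chart coordinate. *)
Lemma ell_slope_chart g u s : pos u != pos g -> slope (pos g) (pos u) != Some s ->
  exists2 c, c != 0 & ell pos g u =
    c *: (X g - slope_chart s (slope (pos g) (pos u)) *: (Y g - s *: X g)).
Proof.
move=> ug; rewrite /slope /ell /slope_chart; case: ((pos u).1 =P (pos g).1) => [E _|/eqP u1 us].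
  exists ((pos u).2 - (pos g).2).
    apply: contraNneq ug => /eqP; rewrite subr_eq0 => /eqP E2.
    by rewrite [pos u]surjective_pairing E E2 -surjective_pairing.
  by rewrite E subrr scale0r subr0 -!mul_mpolyC; ring.
have u1' : (pos u).1 - (pos g).1 != 0 by rewrite subr_eq0.
set dx := _.1 - _ in us u1' *; set dy := _.2 - _ in us *; clearbody dx dy.
have c0 : dy - s * dx != 0.
  apply: contraNneq us => /eqP; rewrite subr_eq0 => /eqP ->.
  by rewrite mulfK.
have cE : (dy - s * dx) * (dy / dx - s)^-1 = dx.
  have -> : dy / dx - s = (dy - s * dx) / dx by rewrite mulrBl mulfK.
  by rewrite invf_div mulrCA mulfV // mulr1.
exists (dy - s * dx) => //; rewrite scalerBr scalerA cE -!mul_mpolyC mpolyCB mpolyCM; ring.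
Qed.

(** The first two factors form a homogeneous polynomial of degree i + j in coordinates centred at
    [g], which is a combination of multiples of the (rho+1)-st powers of the edge forms. Two linear
    factors suffice because two barycentric coordinates of a triangle vanish at each vertex. *)
Lemma vertex_ideal_high_order (rr : {set V} -> int) g (rho d : nat) (c1 c2 c3 c4 : R) i j w :
  int_vertex pos faces g ->
  (forall u, [set u; g] \in edges faces -> rr [set u; g] = rho) ->
  (2 <= nslopes pos faces g)%N -> OmegaNum rho (nslopes pos faces g) <= (i + j)%N ->
  (i + j + d = m)%N -> Pm d w ->
  inJv pos faces m rr g
    ((c1 *: X g + c2 *: Y g) ^+ i * (c3 *: X g + c4 *: Y g) ^+ j * w).
Proof.
move=> ig rrg n2 /(OmegaNum_lt n2) [rd dn] ijd dw.
set t := undup [seq slope (pos g) (pos u) | u <- enum V & [set u; g] \in edges faces].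
have tE : size t = nslopes pos faces g by [].
have [s st] := exists_Some_notin t.
set x : {mpoly R[2]} := X g; set y : {mpoly R[2]} := Y g; set z := y - s *: x.
have x1 : Pm 1 x by apply: PmB; [exact: Pm_X|exact: PmC].
have z1 : Pm 1 z by apply: PmB; [apply: PmB; [exact: Pm_X|exact: PmC]|exact: PmZ].
have lin a b : a *: x + b *: y = (a + b * s) *: x + b *: z.
  by rewrite /z -!mul_mpolyC mpolyCD mpolyCM; ring.
rewrite !lin.
have [p sp <-] := lin_exp_mul_homogenize x z (c1 + c2 * s) c2 (c3 + c4 * s) c4 i j.
set n := (i + j)%N in rd dn ijd sp *.
have [||||q sq ->] := @power_blocks_span R n (map (slope_chart s) t) (fun=> (n - rho)%N) p.
- by rewrite map_inj_in_uniq ?undup_uniq //; apply: slope_chart_inj.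
- by move=> a _; rewrite leqW // leq_subr.
- by rewrite big_const_seq count_predT iter_addn_0 size_map tE mulnC.
- exact: sp.
(* The block size n - rho was chosen so that the exponent of each linear form is exactly rho + 1. *)
have -> : (n.+1 - (n - rho) = rho.+1)%N by lia.
have nE : n = (rho.+1 + (n - rho).-1)%N by lia.
rewrite homogenize_sum mulr_suml big_seq; elim/big_ind: _ => [||a].
- exact: inJv0.
- exact: inJvD.
move=> /[dup] /sq sqa /mapP [o]; rewrite mem_undup => ot aE.
have ost : o != Some s by apply: contraNneq st => <-; rewrite mem_undup.
case/mapP: ot => u; rewrite mem_filter => /andP [ue _] oE.
have [|c c0 ellE] := @ell_slope_chart g u s (edge_pos_neq triang ue); first by rewrite -oE.
have gu : g \in [set u; g] by rewrite !inE eqxx orbT.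
apply: (inJv_edge (e := [set u; g])) => //; first exact/int_edgesP/int_edge_at.
rewrite rrg // nE homogenize_XsubC_exp; last by rewrite prednK ?subn_gt0.
split.
  rewrite -ijd -/n [U in Pm (U + _)]nE; apply: PmM => //; apply: PmM.
    by apply: Pm_exp; apply: PmB => //; apply: PmZ.
  exact: Pm_homogenize.
exists g, u; split; first by rewrite setUC.
have -> : absz (rho%:Z + 1) = rho.+1 by lia.
(* The chart form is [ell pos g u] divided by [c], whence the power of the inverse of [c]. *)
exists (c^-1 ^+ rho.+1 *: (homogenize x z (n - rho).-1 (q a) * w)).
rewrite -mulrA ellE -oE -aE exprZn -scalerAl -scalerAr scalerA -exprMn divff //.
by rewrite expr1n scale1r.
Qed.
End VertexIdeal.

(** * The ideals of a triangle *)

Section BarycentricSpan.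
Variables (R : realType) (x y z : {mpoly R[2]}) (m : nat) (P : {mpoly R[2]} -> Prop).
Hypothesis P0 : P 0.
Hypothesis PD : forall p q, P p -> P q -> P (p + q).
Hypothesis PZ : forall c p, P p -> P (c *: p).
Hypothesis Pmon : forall a b c, (a + b + c = m)%N -> P (x ^+ a * y ^+ b * z ^+ c).

Let linear_comb (l : {mpoly R[2]}) := exists a b c : R, l = a *: x + b *: y + c *: z.

(** Expand the product one factor at a time, collecting the chosen coordinates in the monomial;
    every fully expanded monomial has degree [m]. *)
Lemma barycentric_prod (ls : seq {mpoly R[2]}) a b c :
  (forall l, l \in ls -> linear_comb l) -> (a + b + c + size ls = m)%N ->
  P (x ^+ a * y ^+ b * z ^+ c * \prod_(l <- ls) l).
Proof.
elim: ls a b c => [|l ls IH] a b c lsP /= abc.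
  by rewrite big_nil mulr1; apply: Pmon; rewrite -abc addn0.
have {}IH i j k : (i + j + k + size ls = m)%N ->
    P (x ^+ i * y ^+ j * z ^+ k * \prod_(l <- ls) l).
  by apply: IH => l' l'in; apply: lsP; rewrite inE l'in orbT.
have [|al [be [ga ->]]] := lsP l; first by rewrite inE eqxx.
rewrite big_cons.
have -> : x ^+ a * y ^+ b * z ^+ c * ((al *: x + be *: y + ga *: z) * \prod_(j <- ls) j) =
    al *: (x ^+ a.+1 * y ^+ b * z ^+ c * \prod_(j <- ls) j) +
    be *: (x ^+ a * y ^+ b.+1 * z ^+ c * \prod_(j <- ls) j) +
    ga *: (x ^+ a * y ^+ b * z ^+ c.+1 * \prod_(j <- ls) j).
  by rewrite -!mul_mpolyC !exprS; ring.
by apply: PD; [apply: PD|]; apply: PZ; apply: IH; lia.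
Qed.

Lemma barycentric_span p :
  linear_comb 1 -> linear_comb 'X_ord0 -> linear_comb 'X_ord_max -> Pm m p -> P p.
Proof.
move=> l1 lX lY mp; rewrite (mpolyE p) big_seq; elim/big_ind: _ => // e /msize_mdeg_lt em.
apply: PZ; have {}em : (mdeg e <= m)%N by rewrite -ltnS (leq_trans em).
have liftE : lift ord0 ord0 = ord_max :> 'I_2 by apply: val_inj.
move: em; rewrite mdegE !big_ord_recl big_ord0 addn0 liftE => em.
rewrite mpolyXE_id !big_ord_recl big_ord0 mulr1 liftE.
(* Padding with factors 1, the sum of the barycentric coordinates in the application, gives exactly
   [m] factors even for monomials of lower degree. *)
have -> : 'X_ord0 ^+ e ord0 * 'X_ord_max ^+ e ord_max = 
    x ^+ 0 * y ^+ 0 * z ^+ 0 * \prod_(l <- nseq (e ord0) 'X_ord0 ++ nseq (e ord_max) 'X_ord_max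
      ++ nseq (m - (e ord0 + e ord_max)) 1) l :> {mpoly R[2]}.
  by rewrite !big_cat !big_nseq !iter_mulr_1 expr1n /= !expr0 !mul1r mulr1.
apply: barycentric_prod.
  by move=> l; rewrite !mem_cat !mem_nseq => /or3P [] /andP [_ /eqP ->].
by rewrite !size_cat !size_nseq !add0n addnA subnKC.
Qed.
End BarycentricSpan.

(** * Chains, incidence signs and enlarged ideals *)

Section Chains.
Variables (R : realType) (V : finType) (pos : V -> R * R) (faces : {set {set V}}) (m : nat).

Lemma inJvZ rr g c p : inJv pos faces m rr g p -> inJv pos faces m rr g (c *: p).
Proof.
move=> [f [fJ ->]]; exists (fun e => c *: f e); split; last by rewrite scaler_sumr.
move=> e ei ge; have [mp [u [v [eE [q fE]]]]] := fJ e ei ge; split; first exact: PmZ.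
by exists u, v; split=> //; exists (c *: q); rewrite fE scalerAr.
Qed.

Lemma inJv_mono rr rr' g p :
  (forall e q, e \in int_edges pos faces -> g \in e ->
     inJe pos m (rr e) e q -> inJe pos m (rr' e) e q) ->
  inJv pos faces m rr g p -> inJv pos faces m rr' g p.
Proof. by move=> h [f [fJ ->]]; exists f; split=> // e ei ge; apply: h (fJ e ei ge). Qed.

Lemma sgn1E (u v : V) : sgn1 R [set u; v] v = if (enum_rank u < enum_rank v)%N then 1 else -1.
Proof.
rewrite /sgn1; case: existsP => [[w /andP [/eqP E]]|h].
  by have [[-> _]|[-> <-]] := set2_inj E => ->.
by case: ifP => // uv; case: h; exists u; rewrite eqxx uv.
Qed.

Lemma sgn1_sqr e (g : V) : sgn1 R e g * sgn1 R e g = 1.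
Proof. by rewrite /sgn1; case: ifP; rewrite ?mulrNN mulr1. Qed.

Lemma sgn1_opp (u v : V) : u != v -> sgn1 R [set u; v] u = - sgn1 R [set u; v] v.
Proof.
move=> uv; rewrite sgn1E setUC sgn1E.
have : enum_rank u != enum_rank v :> nat by rewrite (inj_eq val_inj) (inj_eq enum_rank_inj).
by case: ltngtP => // _ _; rewrite opprK.
Qed.

Lemma d1B c c' g : d1 pos faces (fun e => c e - c' e) g = d1 pos faces c g - d1 pos faces c' g.
Proof. by rewrite /d1 -sumrB; apply: eq_bigr => e _; rewrite scalerBr. Qed.

Lemma d1D c c' g : d1 pos faces (fun e => c e + c' e) g = d1 pos faces c g + d1 pos faces c' g.
Proof. by rewrite /d1 -big_split; apply: eq_bigr => e _; rewrite scalerDr. Qed.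

Lemma d1_single t p g : t \in int_edges pos faces ->
  d1 pos faces (fun e => if e == t then p else 0) g = if g \in t then sgn1 R t g *: p else 0.
Proof.
move=> ti; rewrite /d1; case: ifP => gt; last first.
  by rewrite big1 // => e /andP [_ ge]; case: eqP => [E|_]; [rewrite -E ge in gt|rewrite scaler0].
rewrite (bigD1 t) ?ti //= eqxx big1 ?addr0 // => e /andP [_ /negPf ->].
by rewrite scaler0.
Qed.

Lemma Pm_d2 c e : (forall s, Pm m (c s)) -> Pm m (d2 pos faces c e).
Proof. by move=> mc; apply: Pm_sum => s _; apply: PmZ. Qed.

Lemma Pm_d1 c g : (forall e, Pm m (c e)) -> Pm m (d1 pos faces c g).
Proof. by move=> mc; apply: Pm_sum => s _; apply: PmZ. Qed.
End Chains.

(** * Sum of the three vertex ideals *)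

Section TriangleIdeals.
Variables (R : realType) (V : finType) (pos : V -> R * R) (faces : {set {set V}}) (m : nat).
Hypothesis triang : is_triangulation pos faces.

Lemma vertex_ideal_ell (rr : {set V} -> int) g u v (rho d : nat) (al be : R) i j w :
  int_vertex pos faces g ->
  (forall u, [set u; g] \in edges faces -> rr [set u; g] = rho) ->
  (2 <= nslopes pos faces g)%N -> OmegaNum rho (nslopes pos faces g) <= (i + j)%N ->
  (i + j + d = m)%N -> Pm d w ->
  inJv pos faces m rr g ((al *: ell pos g u) ^+ i * (be *: ell pos g v) ^+ j * w).
Proof.
move=> ig rrg n2 om ijd dw.
have ellE c t : c *: ell pos g t =
    (c * ((pos t).2 - (pos g).2)) *: ('X_ord0 - ((pos g).1)%:MP) +
    (- (c * ((pos t).1 - (pos g).1))) *: ('X_ord_max - ((pos g).2)%:MP).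
  by rewrite /ell -!mul_mpolyC mpolyCN !mpolyCM; ring.
by rewrite !ellE; apply: (@vertex_ideal_high_order _ _ _ _ _ triang _ _ rho d).
Qed.

(* In barycentric coordinates, a monomial avoiding all three ideals has
   [b + c < Omega1], [a + c < Omega2] and [a + b < Omega3]: summing contradicts the bound. *)
Lemma triangle_ideals_sum (rr : {set V} -> int) (g1 g2 g3 : V) (rho : nat) p :
  orient (pos g1) (pos g2) (pos g3) != 0 ->
  int_vertex pos faces g1 -> int_vertex pos faces g2 -> int_vertex pos faces g3 ->
  (forall u, [set u; g1] \in edges faces -> rr [set u; g1] = rho) ->
  (forall u, [set u; g2] \in edges faces -> rr [set u; g2] = rho) ->
  (forall u, [set u; g3] \in edges faces -> rr [set u; g3] = rho) ->
  (2 <= nslopes pos faces g1)%N -> (2 <= nslopes pos faces g2)%N ->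
  (2 <= nslopes pos faces g3)%N ->
  OmegaNum rho (nslopes pos faces g1) + OmegaNum rho (nslopes pos faces g2)
    + OmegaNum rho (nslopes pos faces g3) - 3 < m%:Z * 2 ->
  Pm m p ->
  exists p1 p2 p3, [/\ inJv pos faces m rr g1 p1, inJv pos faces m rr g2 p2,
    inJv pos faces m rr g3 p3 & p = p1 + p2 + p3].
Proof.
(* [O] is the value of each side's form [ell] at the opposite vertex, so after division by it [x],
   [y], [z] are the barycentric coordinates of [g1], [g2], [g3]. *)
rewrite -oppr_eq0; set O := - orient _ _ _ => O0 i1 i2 i3 r1 r2 r3 n1 n2 n3 om.
set x := O^-1 *: ell pos g2 g3; set y := O^-1 *: ell pos g3 g1; set z := O^-1 *: ell pos g1 g2.
have mx : Pm 1 x by apply/PmZ/Pm_ell.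
have my : Pm 1 y by apply/PmZ/Pm_ell.
have mz : Pm 1 z by apply/PmZ/Pm_ell.
have OV (q s : {mpoly R[2]}) : O *: q = s -> q = O^-1 *: s.
  by move=> <-; rewrite scalerA mulVf // scale1r.
apply: (@barycentric_span _ x y z m (fun q => exists p1 p2 p3,
  [/\ inJv pos faces m rr g1 p1, inJv pos faces m rr g2 p2,
    inJv pos faces m rr g3 p3 & q = p1 + p2 + p3])).
- by exists 0, 0, 0; split; rewrite ?addr0 //; apply: inJv0.
- move=> _ _ [p1 [p2 [p3 [h1 h2 h3 ->]]]] [q1 [q2 [q3 [k1 k2 k3 ->]]]].
  by exists (p1 + q1), (p2 + q2), (p3 + q3); split; [exact: inJvD..|ring].
- move=> c _ [p1 [p2 [p3 [h1 h2 h3 ->]]]].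
  by exists (c *: p1), (c *: p2), (c *: p3); split; [exact: inJvZ..|rewrite !scalerDr].
- move=> a b c abc.
  case: (lerP (OmegaNum rho (nslopes pos faces g1)) (b + c)%N) => h1.
    exists (x ^+ a * y ^+ b * z ^+ c), 0, 0; split; try exact: inJv0; last by rewrite !addr0.
    have -> : x ^+ a * y ^+ b * z ^+ c = y ^+ b * z ^+ c * x ^+ a by ring.
    rewrite /y ellC scalerN -scaleNr.
    by apply: (@vertex_ideal_ell _ _ _ _ rho a) => //; [lia|exact: Pm_exp].
  case: (lerP (OmegaNum rho (nslopes pos faces g2)) (c + a)%N) => h2.
    exists 0, (x ^+ a * y ^+ b * z ^+ c), 0; split; try exact: inJv0; last by rewrite addr0 add0r.
    have -> : x ^+ a * y ^+ b * z ^+ c = z ^+ c * x ^+ a * y ^+ b by ring.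
    rewrite /z ellC scalerN -scaleNr.
    by apply: (@vertex_ideal_ell _ _ _ _ rho b) => //; [lia|exact: Pm_exp].
  (* By integrality each strict inequality loses one, so failure at all three vertices gives 2 m <=
     Omega1 + Omega2 + Omega3 - 3. *)
  case: (lerP (OmegaNum rho (nslopes pos faces g3)) (a + b)%N) => h3; last by lia.
  exists 0, 0, (x ^+ a * y ^+ b * z ^+ c); split; try exact: inJv0; last by rewrite !add0r.
  rewrite /x ellC scalerN -scaleNr.
  by apply: (@vertex_ideal_ell _ _ _ _ rho c) => //; exact: Pm_exp.
(* The coordinates sum to 1, and each Cartesian coordinate is interpolated from its values at the
   vertices. *)
- exists 1, 1, 1; rewrite !scale1r -!scalerDr; apply: OV.
  by rewrite -mul_mpolyC mulr1 /O /orient /ell !(mpolyCN, mpolyCB, mpolyCM); ring.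
- exists (pos g1).1, (pos g2).1, (pos g3).1.
  rewrite !scalerA ![_ * O^-1]mulrC -!scalerA -!scalerDr; apply: OV.
  by rewrite -!mul_mpolyC /O /orient /ell !(mpolyCN, mpolyCB, mpolyCM); ring.
- exists (pos g1).2, (pos g2).2, (pos g3).2.
  rewrite !scalerA ![_ * O^-1]mulrC -!scalerA -!scalerDr; apply: OV.
  by rewrite -!mul_mpolyC /O /orient /ell !(mpolyCN, mpolyCB, mpolyCM); ring.
Qed.
End TriangleIdeals.

(** * Lower acyclicity after relaxing the triangle *)

Unset Implicit Arguments.

Theorem mainTheorem4 (R : realType) (V : finType) (pos : V -> R * R)
    (faces : {set {set V}}) (m : nat) (r : int) (rr : {set V} -> int)
    (g1 g2 g3 : V) :
  is_triangulation pos faces ->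
  -1 <= r ->
  (forall e, int_edge pos faces e -> rr e = r \/ rr e = -1) ->
  lower_acyclic pos faces m rr ->
  (* sigma = {g1,g2,g3} is a face; tau1 = {g3,g1}, tau2 = {g1,g2}, tau3 = {g2,g3},
     so that g_i = tau_i /\ tau_(i+1) *)
  [set g1; g2; g3] \in faces ->
  int_vertex pos faces g1 -> int_vertex pos faces g2 -> int_vertex pos faces g3 ->
  rr [set g3; g1] = r -> rr [set g1; g2] = r -> rr [set g2; g3] = r ->
  (forall e, int_edge pos faces e -> [|| g1 \in e, g2 \in e | g3 \in e] ->
     rr e <> -1) ->
  ((OmegaNum r (nslopes pos faces g1) + OmegaNum r (nslopes pos faces g2)
     + OmegaNum r (nslopes pos faces g3) - 3)%:~R / 2 < (m%:Q)) ->
  lower_acyclic pos faces m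
    (fun e => if e \in [set [set g3; g1]; [set g1; g2]; [set g2; g3]]
              then -1 else rr e).
Proof.
move=> triang r1 rrr [H1 H0] face i1 i2 i3 _ rt12 _ rrN om.
set T := [set _; _; _].
have O0 := orient_face triang face.
have d12 : g1 != g2 by apply: contraNneq O0 => ->; rewrite /orient; apply/eqP; ring.
have d23 : g2 != g3 by apply: contraNneq O0 => ->; rewrite /orient; apply/eqP; ring.
have d31 : g3 != g1 by apply: contraNneq O0 => ->; rewrite /orient; apply/eqP; ring.
have edge u v : u != v -> u \in [set g1; g2; g3] -> v \in [set g1; g2; g3] ->
    [set u; v] \in edges faces.
  move=> uv uf vf; rewrite inE cards2 uv /=; apply/existsP; exists [set g1; g2; g3].
  by rewrite face; apply/subsetP => w; rewrite !in_set2 => /orP [] /eqP ->.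
have [f1 f2 f3] : [/\ g1 \in [set g1; g2; g3], g2 \in [set g1; g2; g3] & g3 \in [set g1; g2; g3]].
  by rewrite !inE !eqxx ?orbT.
have intE g u : int_vertex pos faces g -> [set u; g] \in edges faces ->
    [set u; g] \in int_edges pos faces.
  by move=> ig ue; apply/int_edgesP/int_edge_at.
have t12i : [set g1; g2] \in int_edges pos faces by apply: intE => //; apply: edge.
have t23i : [set g2; g3] \in int_edges pos faces by apply: intE => //; apply: edge.
(* The edges of the triangle are interior and meet the [g_i], so r is nonnegative; hence every edge
   at a [g_i] has smoothness exactly r. *)
have rN1 : r <> -1.
  by rewrite -rt12; apply: rrN; [exact/int_edgesP|rewrite !inE eqxx].
have [rho rE] : exists rho : nat, r = rho by exists (absz r); lia.
have rrg g u : g \in [set g1; g2; g3] -> int_vertex pos faces g ->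
    [set u; g] \in edges faces -> rr [set u; g] = rho.
  move=> gf ig ue; have iug := int_edge_at ig ue.
  case: (rrr _ iug) => [->//|]; have := rrN _ iug => h /h [].
  by move: gf; rewrite !inE => /orP [/orP []|] /eqP ->; rewrite !eqxx ?orbT.
have n1 : (2 <= nslopes pos faces g1)%N.
  by apply: (@nslopes_ge2 _ _ _ _ g1 g2 g3) => //; apply: edge; rewrite // eq_sym.
have n2 : (2 <= nslopes pos faces g2)%N.
  apply: (@nslopes_ge2 _ _ _ _ g2 g3 g1); [by apply: edge; rewrite // eq_sym..|].
  by move: O0; rewrite /orient; apply: contraNneq => E; apply/eqP; rewrite -E; ring.
have n3 : (2 <= nslopes pos faces g3)%N.
  apply: (@nslopes_ge2 _ _ _ _ g3 g1 g2); [by apply: edge; rewrite // eq_sym..|].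
  by move: O0; rewrite /orient; apply: contraNneq => E; apply/eqP; rewrite -E; ring.
have sumJ p : Pm m p -> exists p1 p2 p3, [/\ inJv pos faces m rr g1 p1,
    inJv pos faces m rr g2 p2, inJv pos faces m rr g3 p3 & p = p1 + p2 + p3].
  apply: (@triangle_ideals_sum _ _ _ _ _ triang rr g1 g2 g3 rho) => //.
  - by move=> u; apply: rrg.
  - by move=> u; apply: rrg.
  - by move=> u; apply: rrg.
  by move: om; rewrite rE ltr_pdivrMr // -[2]/(2%:~R) -intrM ltr_int.
have relax e q : e \in int_edges pos faces -> inJe pos m (rr e) e q ->
    inJe pos m (if e \in T then -1 else rr e) e q.
  move=> /int_edgesP [ee _] qJ; case: ifP => // _.
  exact: (inJeN1 pos ee (inJe_Pm qJ)).
split; last first.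
  (* The vertex ideals only grow, so the chain found for [rr] still works. *)
  move=> c0 mc0; have [c1 [mc1 c1J]] := H0 c0 mc0; exists c1; split=> // g ig.
  by apply: inJv_mono (c1J g ig) => e q ei _; apply: relax.
move=> c1 mc1 c1J.
(* The boundary at [g_i] need not lie in J_i, because the relaxed ideal there is larger. Splitting
   the total boundary over the three vertices as j1 + j2 + j3 leaves residues F g_i - j_i of sum
   zero, to be removed by a chain on the triangle. *)
pose F g := d1 pos faces c1 g.
have mF g : Pm m (F g) by apply: Pm_d1.
have [j1 [j2 [j3 [J1 J2 J3 FE]]]] := sumJ _ (PmD (PmD (mF g1) (mF g2)) (mF g3)).
(* A correction supported on two of the three edges suffices because the three residues sum
   to zero. *)
pose a := sgn1 R [set g1; g2] g1 *: (F g1 - j1).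
pose b := sgn1 R [set g2; g3] g3 *: (F g3 - j3).
have ma : Pm m a by apply: PmZ; apply: PmB => //; apply: inJv_Pm J1.
have mb : Pm m b by apply: PmZ; apply: PmB => //; apply: inJv_Pm J3.
pose h e := (if e == [set g1; g2] then a else 0) + (if e == [set g2; g3] then b else 0).
have mh e : Pm m (h e) by apply: PmD; case: ifP => // _; apply: Pm0.
have d1h g : d1 pos faces h g =
    (if g \in [set g1; g2] then sgn1 R [set g1; g2] g *: a else 0) +
    (if g \in [set g2; g3] then sgn1 R [set g2; g3] g *: b else 0).
  by rewrite d1D !d1_single.
have d21 : g2 != g1 by rewrite eq_sym.
have d32 : g3 != g2 by rewrite eq_sym.
have d13 : g1 != g3 by rewrite eq_sym.
have h1 : d1 pos faces h g1 = F g1 - j1.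
  rewrite d1h !inE eqxx (negPf d12) (negPf d13) /= addr0 /a scalerA.
  by rewrite sgn1_sqr scale1r.
have h3 : d1 pos faces h g3 = F g3 - j3.
  rewrite d1h !inE eqxx (negPf d31) (negPf d32) /= add0r /b scalerA.
  by rewrite sgn1_sqr scale1r.
(* The coefficients [a] and [b] were fixed at [g1] and [g3]. Opposite signs at the two ends of an
   edge give minus the sum of those residues at [g2]. *)
have h2 : d1 pos faces h g2 = F g2 - j2.
  rewrite d1h !inE eqxx (negPf d21) /= /a /b !scalerA.
  rewrite (sgn1_opp _ d12) mulrN sgn1_sqr (sgn1_opp _ d23) mulNr sgn1_sqr !scaleN1r.
  have -> : F g2 = j1 + j2 + j3 - F g1 - F g3 by rewrite -FE; ring.
  ring.
have [||c2 [mc2 c2J]] := H1 (fun e => c1 e - h e).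
- by move=> e; apply: PmB.
- move=> g ig; rewrite d1B; case: (eqVneq g g1) => [->|gg1].
    by rewrite h1 subKr.
  case: (eqVneq g g2) => [->|gg2]; first by rewrite h2 subKr.
  case: (eqVneq g g3) => [->|gg3]; first by rewrite h3 subKr.
  (* Away from the triangle the correction has no boundary, and no relaxed edge contains [g], so the
     two vertex ideals agree. *)
  rewrite d1h !inE (negPf gg1) (negPf gg2) (negPf gg3) /= addr0 subr0.
  apply: inJv_mono (c1J g ig) => e q ei ge; case: ifP => // eT.
  move: eT ge; rewrite !inE => /orP [/orP []|] /eqP ->;
    by rewrite !inE ?(negPf gg1) ?(negPf gg2) ?(negPf gg3).
(* On a relaxed edge the ideal is all of P_m; on any other edge [h] vanishes. *)
exists c2; split=> // e ei; case: ifP => [eT|].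
  have [ee _] := ei; apply: (inJeN1 pos ee); apply: PmB => //; exact: Pm_d2.
rewrite !inE => /negbT; rewrite !negb_or => /andP [/andP [_ e12] e23].
by have := c2J e ei; rewrite /h (negPf e12) (negPf e23) addr0 subr0.
Qed.
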